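(* The following eight mesh patterns $(12,R)$ are pairwise equidistributed, where $R$ ranges over: $\{(1,2),(2,2),(0,1),(1,1),(2,1),(0,0)\}$, $\{(1,2),(2,2),(0,1),(1,1),(0,0),(1,0)\}$, $\{(1,2),(2,2),(1,1),(2,1),(0,0),(1,0)\}$, $\{(2,2),(0,1),(1,1),(2,1),(0,0),(1,0)\}$, $\{(0,2),(2,2),(0,1),(1,1),(2,1),(1,0)\}$, $\{(0,2),(1,2),(1,1),(2,1),(0,0),(1,0)\}$, $\{(1,2),(0,1),(1,1),(2,1),(0,0),(2,0)\}$, $\{(1,2),(2,2),(0,1),(1,1),(1,0),(2,0)\}$. Moreover, for each such pattern $p$, with $F(x)=\sum_{n\ge0}n!x^n$, $A(x)=\sum_{n\ge0}s_{n,0}(p)x^n$ and $F(x,q)=\sum_{n\ge0}x^n\sum_{\pi\in S_n}q^{p(\pi)}$, $$A(x)=\frac{F(x)}{1+x(F(x)-1)},\qquad F(x,q)=\frac{F(x)}{1+(1-q)x(F(x)-1)}.$$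
   Context: For $R\subseteq\{0,1,2\}^2$ and $\pi=\pi_1\cdots\pi_n\in S_n$, an occurrence of the mesh pattern $(12,R)$ in $\pi$ is a pair of positions $i_1<i_2$ with $\pi_{i_1}<\pi_{i_2}$ such that, setting $x_0=0,x_1=i_1,x_2=i_2,x_3=n+1$ and $y_0=0,y_1=\pi_{i_1},y_2=\pi_{i_2},y_3=n+1$, for every $(a,b)\in R$ there is no index $k$ with $x_a<k<x_{a+1}$ and $y_b<\pi_k<y_{b+1}$. $p(\pi)$ is the number of occurrences of $p$ in $\pi$; $s_{n,k}(p)$ the number of $\pi\in S_n$ with $p(\pi)=k$; $p_1,p_2$ are equidistributed if $s_{n,k}(p_1)=s_{n,k}(p_2)$ for all $n,k\ge 0$. Generating functions are formal power series. *)

(* Defs.v *)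
From HB Require Import structures.
From mathcomp Require Import all_boot all_order all_algebra all_fingroup.

Set Implicit Arguments.
Unset Strict Implicit.
Unset Printing Implicit Defensive.

Import GRing.Theory.
Local Open Scope ring_scope.

(* Formal power series, represented by their coefficient sequences; equality
   of series is coefficientwise equality [=1]. *)

Definition fps (R : Type) := nat -> R.

Section FPS.
Variable R : comUnitRingType.
Implicit Types f g : fps R.

Definition fps_const (c : R) : fps R := fun n => if n == 0%N then c else 0.
Definition fps_X : fps R := fun n => (n == 1%N)%:R.
Definition fps_add f g : fps R := fun n => f n + g n.
Definition fps_opp f : fps R := fun n => - f n.
Definition fps_mul f g : fps R := fun n => \sum_(i < n.+1) f i * g (n - i)%N.

(* [fps_inv_seq f n] lists the coefficients 0, ..., n of 1/f, obtained by
   solving f * g = 1 degree by degree; it is the inverse of f as soon as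
   f 0 is a unit, see [fps_mulV]. *)
Fixpoint fps_inv_seq f (n : nat) : seq R :=
  if n is m.+1 then
    let s := fps_inv_seq f m in
    rcons s (- (f 0%N)^-1 * \sum_(i < m.+1) f i.+1 * s`_(m - i))
  else [:: (f 0%N)^-1].

Definition fps_inv f : fps R := fun n => (fps_inv_seq f n)`_n.
Definition fps_div f g : fps R := fps_mul f (fps_inv g).

Lemma size_fps_inv_seq f n : size (fps_inv_seq f n) = n.+1.
Proof. by elim: n => //= n IHn; rewrite size_rcons IHn. Qed.

Lemma nth_fps_inv_seq f n i : (i <= n)%N -> (fps_inv_seq f n)`_i = fps_inv f i.
Proof.
elim: n => [|n IHn]; first by rewrite leqn0 => /eqP->.
rewrite leq_eqVlt => /predU1P[-> //|lt_i_n].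
by rewrite /= nth_rcons size_fps_inv_seq lt_i_n IHn.
Qed.

Lemma fps_invS f n :
  fps_inv f n.+1 = - (f 0%N)^-1 * \sum_(i < n.+1) f i.+1 * fps_inv f (n - i)%N.
Proof.
rewrite /fps_inv /= nth_rcons size_fps_inv_seq ltnn eqxx; congr (_ * _).
by apply: eq_bigr => i _; rewrite nth_fps_inv_seq // leq_subr.
Qed.

Lemma fps_mulV f :
  f 0%N \is a GRing.unit -> fps_mul f (fps_inv f) =1 fps_const 1.
Proof.
move=> Uf [|n]; first by rewrite /fps_mul big_ord1 /= divrr.
rewrite /fps_mul big_ord_recl /= fps_invS mulrA mulrN divrr // mulN1r.
by apply/eqP; rewrite addrC subr_eq0; apply/eqP/eq_bigr => i _; rewrite subSS.
Qed.

End FPS.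

Arguments fps_X {R}.

Declare Scope fps_scope.
Delimit Scope fps_scope with S.
Notation "c %:S" := (fps_const c) (at level 2, left associativity, format "c %:S")
  : fps_scope.
Notation "1" := (fps_const 1%R) : fps_scope.
Notation "''x'" := fps_X (at level 0) : fps_scope.
Notation "f + g" := (fps_add f g) : fps_scope.
Notation "f - g" := (fps_add f (fps_opp g)) : fps_scope.
Notation "f * g" := (fps_mul f g) : fps_scope.
Notation "f / g" := (fps_div f g) : fps_scope.

(* The mesh pattern (12, R) is represented by its set R of shaded boxes. *)
Definition mesh12 := {set 'I_3 * 'I_3}.

(* A permutation of {1, ..., n} is encoded as s : 'S_n acting on
   'I_n = {0, ..., n-1}: the 1-based position k.+1 carries the 1-based value
   (s k).+1. [cut n u v] is then the sequence 0, u+1, v+1, n+1, i.e. the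
   x_0, ..., x_3 (resp. y_0, ..., y_3) for 0-based positions (resp. values)
   u and v. *)
Definition cut (n u v a : nat) : nat := nth 0%N [:: 0; u.+1; v.+1; n.+1]%N a.

Definition is_occurrence (n : nat) (p : mesh12) (s : 'S_n) (i1 i2 : 'I_n) : bool :=
  [&& (i1 < i2)%N, (s i1 < s i2)%N &
      [forall c in p, ~~ [exists k : 'I_n,
         (cut n i1 i2 c.1 < k.+1 < cut n i1 i2 c.1.+1)%N &&
         (cut n (s i1) (s i2) c.2 < (s k).+1 < cut n (s i1) (s i2) c.2.+1)%N]]].

Definition occurrences (n : nat) (p : mesh12) (s : 'S_n) : nat :=
  #|[set ij : 'I_n * 'I_n | is_occurrence p s ij.1 ij.2]|.

Definition s_count (p : mesh12) (n k : nat) : nat :=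
  #|[set s : 'S_n | occurrences p s == k]|.

Definition equidistributed (p1 p2 : mesh12) : Prop :=
  forall n k : nat, s_count p1 n k = s_count p2 n k.

Definition fact_series (R : comUnitRingType) : fps R := fun n => (n`!)%:R.

Definition avoidance_series (p : mesh12) : fps int := fun n => (s_count p n 0)%:R.

(* F(x, q) as a series in x over Z[q]; the variable 'X of {poly int} is q. *)
Definition distribution_series (p : mesh12) : fps {poly int} :=
  fun n => \sum_(s : 'S_n) 'X^(occurrences p s).

Definition boxes (l : seq (nat * nat)) : mesh12 :=
  [set c : 'I_3 * 'I_3 | (val c.1, val c.2) \in l].

Definition eight_patterns : seq mesh12 := map boxes
  [:: [:: (1,2); (2,2); (0,1); (1,1); (2,1); (0,0)];
      [:: (1,2); (2,2); (0,1); (1,1); (0,0); (1,0)];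
      [:: (1,2); (2,2); (1,1); (2,1); (0,0); (1,0)];
      [:: (2,2); (0,1); (1,1); (2,1); (0,0); (1,0)];
      [:: (0,2); (2,2); (0,1); (1,1); (2,1); (1,0)];
      [:: (0,2); (1,2); (1,1); (2,1); (0,0); (1,0)];
      [:: (1,2); (0,1); (1,1); (2,1); (0,0); (2,0)];
      [:: (1,2); (2,2); (0,1); (1,1); (1,0); (2,0)]]%N.

(* Main.v *)
(** Let D_n(q) be the sum of q^p(pi) over S_n. Up to inverse and
    reverse-complement, which preserve the pattern 12, only the first and the
    fifth pattern matter. For both, an occurrence uses consecutive values v and
    v+1, and the letters larger than v+1 form a contiguous factor; the
    occurrences of p with a larger bottom value are precisely the occurrences
    of p in that factor. Cutting at a marked occurrence is thus a bijection onto
    pairs (u, t) of arbitrary permutations of sizes a and b > 0, where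
    a + b + 1 = n. Expanding q^c - 1 = (q - 1)(1 + q + ... + q^(c-1)), with the
    occurrences of pi ordered by decreasing bottom value, yields
      D_n = n! + (q - 1) sum_{a + b + 1 = n, b > 0} b! D_a,
    i.e. F(x,q) = F(x) + (q - 1) x (F(x) - 1) F(x,q); then put q = 0. *)

Require Import Defs.
From mathcomp Require Import all_boot all_order all_algebra all_fingroup.
From mathcomp Require Import zify ring.

Set Implicit Arguments.
Unset Strict Implicit.
Unset Printing Implicit Defensive.

Import GRing.Theory.
Local Open Scope ring_scope.

(** * Power series: from a recurrence on coefficients to a quotient *)

Section PowerSeries.
Variable R : comUnitRingType.
Implicit Types f g h : fps R.

(** A coefficient of a product depends only on truncations, so associativity of [fps_mul] is
    inherited from polynomials. *)
Lemma fps_mul_coefM N f g n : (n < N)%N ->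
  fps_mul f g n = ((\poly_(i < N) f i) * (\poly_(i < N) g i))`_n.
Proof.
move=> ltnN; rewrite coefM; apply: eq_bigr => i _.
have lti := ltn_ord i; rewrite !coef_poly.
by rewrite (leq_ltn_trans (leq_subr _ _) ltnN) (leq_trans lti ltnN).
Qed.

Lemma fps_mulA f g h : fps_mul f (fps_mul g h) =1 fps_mul (fps_mul f g) h.
Proof.
move=> n; pose P (e : fps R) := \poly_(i < n.+1) e i.
transitivity ((P f * P g * P h)`_n); last first.
  rewrite coefM; apply: eq_bigr => i _.
  by rewrite (@fps_mul_coefM n.+1) // coef_poly ltnS leq_subr.
rewrite -mulrA coefM; apply: eq_bigr => i _.
by rewrite (@fps_mul_coefM n.+1) ?ltnS ?leq_subr // coef_poly ltn_ord.
Qed.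

Lemma fps_mulr1 f : fps_mul f (fps_const 1) =1 f.
Proof.
move=> n; rewrite /fps_mul big_ord_recr /= subnn mulr1 big1 ?add0r // => i _.
by rewrite /fps_const subn_eq0 leqNgt ltn_ord mulr0.
Qed.

Lemma fps_divP f g h :
  g 0%N \is a GRing.unit -> fps_mul f g =1 h -> f =1 fps_div h g.
Proof.
move=> Ug fg n; rewrite -[LHS]fps_mulr1.
transitivity (fps_mul (fps_mul f g) (fps_inv g) n).
  by rewrite -fps_mulA; apply: eq_bigr => i _; rewrite fps_mulV.
by apply: eq_bigr => i _; rewrite fg.
Qed.

Lemma fps_mulXl f n : fps_mul fps_X f n.+1 = f n.
Proof.
rewrite /fps_mul big_ord_recl big_ord_recl big1 => [|i _]; last by rewrite mul0r.
by rewrite mul0r add0r addr0 mul1r /= subSS subn0.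
Qed.

Lemma fps_mulCl c f n : fps_mul (fps_const c) f n = c * f n.
Proof.
rewrite /fps_mul big_ord_recl big1 => [|i _]; last by rewrite mul0r.
by rewrite addr0 /= subn0.
Qed.

(* The hypothesis is [D = F + (c - 1) x (F - 1) D], coefficient by coefficient. *)
Lemma fps_div_fact (D : fps R) (c : R) (G : fps R) :
  (forall n, D n = (n`!)%:R +
     (c - 1) * \sum_(v < n.-1) (v.+1`!)%:R * D (n.-2 - v)%N) ->
  G 0%N = 1 -> G 1%N = 0 -> (forall m, G m.+2 = (1 - c) * (m.+1`!)%:R) ->
  D =1 fps_div (fact_series R) G.
Proof.
move=> recD G0 G1 GS; apply: fps_divP => [|n]; first by rewrite G0 unitr1.
rewrite /fps_mul /fact_series big_ord_recr /= subnn G0 mulr1 [D n]recD.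
case: n => [|n]; first by rewrite !big_ord0 mulr0 addr0 add0r.
rewrite big_ord_recr /= subSnn G1 mulr0 addr0 [X in X + _](_ : _ =
  (1 - c) * \sum_(v < n) (v.+1`!)%:R * D (n.-1 - v)%N).
  by rewrite mulrBl mulrBl; ring.
rewrite (reindex_inj rev_ord_inj) /= mulr_sumr; apply: eq_bigr => i _.
have lti := ltn_ord i.
rewrite (_ : (n.+1 - (n - i.+1) = i.+2)%N); last by lia.
rewrite GS (_ : (n.-1 - i = n - i.+1)%N); last by lia.
by rewrite mulrC mulrA.
Qed.

End PowerSeries.

(** * Geometric expansion, and occurrences read in one-line notation *)

(* Telescoping of a geometric sum. *)
Lemma expX_count_sub1 (R : comNzRingType) (x : R) (P : pred nat) m n :
  x ^+ count P (iota m n) = 1 + (x - 1) *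
    \sum_(v <- iota m n | P v) x ^+ count P (iota v.+1 (m + n - v.+1)).
Proof.
elim: n m => [|n IHn] m; first by rewrite big_nil mulr0 addr0.
rewrite /= big_cons exprD; move: (IHn m.+1); rewrite addSnnS => ->.
rewrite (_ : (m + n.+1 - m.+1 = n)%N); last by lia.
case: (P m); last by rewrite expr0 mul1r.
rewrite expr1 IHn addSnnS; ring.
Qed.

(* The middle row is shaded in the first and in the fifth pattern, so that an
   occurrence in the one-line notation [w] uses two consecutive values [v] and
   [v.+1]. The other letters are then larger exactly when they lie in the
   vertical strip [h], with [h = 0] for the first pattern and [h = 1] for the
   fifth. *)
Definition occ_at (h : nat) (w : seq nat) (v : nat) : bool :=
  [&& v.+1 \in w, (index v w < index v.+1 w)%N &
   all (fun y => [|| y == v, y == v.+1 | (v < y)%N ==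
     ((index v w < index y w) + (index v.+1 w < index y w) == h)%N]) w].

Definition occs h w := count (occ_at h w) (iota 0 (size w)).

Lemma occ_at_mem h w v : occ_at h w v -> (v \in w) && (v.+1 \in w).
Proof.
case/and3P=> v1w ltv _; rewrite v1w andbT -index_mem.
by rewrite (ltn_trans ltv) ?index_mem.
Qed.

(** An absent letter has the size of the word as its index, so it counts as lying after [v]. *)
Lemma lt_index_mid (T : eqType) (m r : seq T) v y : v \notin m ->
  (index v (m ++ v :: r) < index y (m ++ v :: r))%N = (y \notin m) && (y != v).
Proof.
move=> vm; rewrite !index_cat (negPf vm) index_head addn0 /= eq_sym.
case: ifP => [ym|_]; first by rewrite ltnNge ltnW ?index_mem.
by case: eqP; lia.
Qed.

(** Strip 0 is what precedes [v], since [v.+1] comes later; the letters above [v.+1] are therefore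
    exactly the prefix before [v]. *)
Lemma occ_at0P w v : uniq w ->
  reflect (exists m r, [/\ w = m ++ v :: r, all (ltn v.+1) m,
             all (geq v.+1) r & v.+1 \in r]) (occ_at 0 w v).
Proof.
move=> Uw; apply: (iffP idP) => [ow|[m] [r] [Dw /allP hm /allP hr v1r]].
  have /andP[vw _] := occ_at_mem ow.
  case/splitPr: vw Uw ow => m r; rewrite cat_uniq => /and3P[_ dmr /andP[vr _]].
  have vm: v \notin m by apply: contra dmr => vm; apply/hasP; exists v; rewrite ?inE ?eqxx.
  case/and3P; rewrite lt_index_mid // => v1w /andP[v1m _] /allP hy.
  have v1r : v.+1 \in r.
    by move: v1w; rewrite mem_cat inE (negPf v1m); case/predU1P => // /eqP; lia.
  exists m, r; split=> //; apply/allP => y yi /=.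
    have := hy y; rewrite mem_cat yi => /(_ isT) /or3P[/eqP Dy | /eqP Dy|].
    - by rewrite -Dy yi in vm.
    - by rewrite -Dy yi in v1m.
    rewrite lt_index_mid // yi /= add0n => /eqP.
    have yv1: y != v.+1 by apply: contraNneq v1m => <-.
    have : ((index v.+1 (m ++ v :: r) < index y (m ++ v :: r))%N) = false.
      rewrite !index_cat yi (negPf v1m).
      by apply/negbTE; rewrite -leqNgt (leq_trans (ltnW _) (leq_addr _ _)) ?index_mem.
    by move=> -> /=; lia.
  have ym: y \notin m.
    by apply: contra dmr => ym; apply/hasP; exists y; rewrite // inE yi orbT.
  have yv: y != v by apply: contraNneq vr => <-.
  have := hy y; rewrite mem_cat inE yi !orbT => /(_ isT).
  by rewrite lt_index_mid // ym yv /=; lia.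
have vm: v \notin m by apply/negP => /hm /=; rewrite ltnNge leqW.
have v1m: v.+1 \notin m by apply/negP => /hm /=; rewrite ltnn.
apply/and3P; rewrite Dw lt_index_mid // v1m mem_cat inE v1r !orbT; split=> //.
  by rewrite andTb; lia.
apply/allP => y; rewrite mem_cat inE => /or3P[ym|/eqP->|yr]; rewrite ?eqxx //.
  rewrite lt_index_mid // ym /=; have /= := hm y ym; rewrite !index_cat ym (negPf v1m).
  by have := ym; rewrite -index_mem; lia.
have yv1 := hr y yr; rewrite /= in yv1.
have ym: y \notin m by apply/negP => /hm /=; lia.
by rewrite lt_index_mid // ym; case: (eqVneq y v) => //= ?; lia.
Qed.

(** Strip 1 is what lies between [v] and [v.+1], so the letters above [v.+1] fill exactly that
    gap. *)
Lemma occ_at1P w v : uniq w ->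
  reflect (exists l m r, [/\ w = l ++ v :: m ++ v.+1 :: r, all (gtn v) l,
             all (ltn v.+1) m & all (gtn v) r]) (occ_at 1 w v).
Proof.
move=> Uw; apply: (iffP idP) => [ow|[l] [m] [r] [Dw /allP hl /allP hm /allP hr]].
  have /andP[vw v1w] := occ_at_mem ow.
  case/splitPr: vw v1w Uw ow => l r1; rewrite mem_cat inE => v1w Uw ow.
  have v_l : v \notin l.
    by move: Uw; rewrite cat_uniq => /and3P[_ /= /norP[]].
  have v1l: v.+1 \notin l.
    by move: ow => /and3P[_ + _]; rewrite lt_index_mid // => /andP[].
  have v1r : v.+1 \in r1.
    by move: v1w; rewrite (negPf v1l) => /predU1P[/eqP|//]; lia.
  case/splitPr: v1r Uw ow {v1w} => m r Uw.
  have v1lm : v.+1 \notin l ++ v :: m.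
    move: Uw; rewrite -cat_cons catA cat_uniq => /and3P[_ + _].
    by move=> /= /norP[].
  move=> /and3P[_ _ /allP hy].
  (* Comparisons of indices become membership in the prefixes ending before [v] and before
     [v.+1]. *)
  have {}hy y : y \in l ++ v :: m ++ v.+1 :: r -> y != v -> y != v.+1 ->
      (v < y)%N = (((y \notin l) + (y \notin l ++ v :: m))%N == 1).
    move=> yw yv yv1; have := hy y yw; rewrite (negPf yv) (negPf yv1) /=.
    rewrite lt_index_mid // yv andbT -cat_cons catA lt_index_mid // yv1 andbT.
    by move/eqP.
  have U2 : uniq ((l ++ v :: m) ++ v.+1 :: r) by rewrite -catA.
  exists l, m, r; split=> //; apply/allP => y yi /=.
  - have := hy y; rewrite !mem_cat yi /= => /(_ isT).
    have: y != v by apply: contraNneq v_l => <-.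
    have: y != v.+1 by apply: contraNneq v1l => <-.
    by lia.
  - have yl : y \notin l.
      apply: contraTN Uw => yl; rewrite cat_uniq; apply/nandP; right.
      by apply/nandP; left; apply/negPn/hasP; exists y; rewrite // !(inE, mem_cat) yi orbT.
    have yv: y != v.
      apply: contraTneq Uw => <-; rewrite cat_uniq /= mem_cat yi /=.
      by rewrite !andbF.
    have yv1 : y != v.+1.
      by apply: contraNneq v1lm => <-; rewrite mem_cat inE yi !orbT.
    have := hy y; rewrite !mem_cat !inE yi mem_cat yi (negPf yl) !orbT.
    by move=> /(_ isT); lia.
  - have ylm : y \notin l ++ v :: m.
      apply: contraTN U2 => ylm; rewrite cat_uniq; apply/nandP; right.
      by apply/nandP; left; apply/negPn/hasP; exists y; rewrite // inE yi orbT.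
    have yv1 : y != v.+1.
      by apply: contraTneq U2 => <-; rewrite cat_uniq /= yi !andbF.
    have := hy y; rewrite (negPf ylm).
    move: ylm; rewrite !mem_cat !inE mem_cat inE yi !orbT.
    by move=> /norP[-> /norP[yv _]] /(_ isT yv yv1); lia.
have v_l: v \notin l by apply/negP => /hl /=; rewrite ltnn.
have v1lm: v.+1 \notin l ++ v :: m.
  rewrite mem_cat inE; apply/negP => /or3P[/hl /=|/eqP|/hm /=]; lia.
apply/and3P; rewrite Dw; split.
- by rewrite !(mem_cat, inE) eqxx !orbT.
- by rewrite lt_index_mid //; move: v1lm; rewrite mem_cat => /norP[-> _]; lia.
apply/allP => y yw; have [->//|yv] := eqVneq y v.
have [->|yv1] := eqVneq y v.+1; first by rewrite orbT.
rewrite lt_index_mid // yv andbT -cat_cons catA lt_index_mid // yv1 andbT /=.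
move: yw; rewrite !(mem_cat, inE) (negPf yv) (negPf yv1) /=.
have [/hl/=|yl] := boolP (y \in l); first by lia.
have [/hm/=|ym] := boolP (y \in m); first by lia.
by move=> /hr /=; lia.
Qed.

(** The outer letters are all smaller than the block, so they must avoid strip [h]. Those of [l] lie
    in strip 0, harmless if [h = 1] or [l] is empty; those of [r] not in [l] lie in strip 2,
    harmless as [h <= 1]. *)
Lemma occ_at_shift h k (l u r : seq nat) x :
  (h <= 1)%N -> (h = 0%N -> l = [::]) -> all (gtn k) l -> all (gtn k) r ->
  occ_at h (l ++ map (addn k) u ++ r) (k + x) = occ_at h u x.
Proof.
move=> h1 h0 /allP hl /allP hr; rewrite /occ_at -addnS.
have kl y : (k + y)%N \in l = false by apply/negP => /hl /=; lia.
have kr y : (k + y)%N \in r = false by apply/negP => /hr /=; lia.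
have ku y : ((k + y)%N \in map (addn k) u) = (y \in u).
  by rewrite mem_map //; apply: addnI.
have idx y : y \in u ->
    index (k + y)%N (l ++ map (addn k) u ++ r) = (size l + index y u)%N.
  by move=> yu; rewrite !index_cat kl ku yu index_map //; apply: addnI.
rewrite !mem_cat kl ku kr orbF /=; case: (boolP (x.+1 \in u)) => //= x1u.
case: (boolP (x \in u)) => xu; last first.
  rewrite !index_cat !kl !ku x1u (negPf xu) index_map; last exact: addnI.
  rewrite size_map (memNindex xu).
  have : (index x.+1 u < size u)%N by rewrite index_mem.
  by move=> lt1; rewrite ltn_add2l !ltnNge (ltnW lt1) (leq_trans (ltnW lt1)) ?leq_addr.
rewrite !idx // ltn_add2l; congr (_ && _).
rewrite !all_cat all_map; set A := all _ l; set B := all _ r.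
have -> : A.
  apply/allP => y yl; have /= yk := hl y yl.
  have : (index y (l ++ map (addn k) u ++ r) < size l)%N.
    by rewrite index_cat yl index_mem.
  have : h = 0%N -> size l = 0%N by move/h0->.
  by lia.
have -> : B.
  apply/allP => y yr; have /= yk := hr y yr.
  have yu : y \notin map (addn k) u by apply/mapP => -[z _]; lia.
  (* Letters may repeat: a letter of [r] that also occurs in [l] has its index there. *)
  have [yl|yl] := boolP (y \in l).
    have : (index y (l ++ map (addn k) u ++ r) < size l)%N.
      by rewrite index_cat yl index_mem.
    have : h = 0%N -> size l = 0%N by move/h0->.
    by lia.
  have := xu; have := x1u; rewrite -!index_mem !index_cat (negPf yl) (negPf yu).
  by rewrite size_map !ltn_add2l => lt1 lt2; rewrite !ltn_addr //; lia.
rewrite /= andbT; apply: eq_in_all => y yu /=.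
by rewrite idx // !eqn_add2l !ltn_add2l leq_add2l.
Qed.

(** Two such occurrences would place [v], [v.+1], [v.+2] in this order, putting the large letter
    [v.+2] in strip 2 of the first one, whereas [h <= 1]. *)
Lemma occ_atS h w v : (h <= 1)%N -> occ_at h w v -> occ_at h w v.+1 = false.
Proof.
move=> h1 ow; apply/negP => ow1.
have /andP[vw _] := occ_at_mem ow; have /andP[_ v2w] := occ_at_mem ow1.
case/and3P: ow => _ lt01 /allP /(_ _ v2w).
case/and3P: ow1 => _ lt12 /allP /(_ _ vw).
by lia.
Qed.

(** * Gluing two permutations along an occurrence *)

(** For [t] on the letters 0, ..., v, [bump v] turns the letter [v] into [v.+1] and so frees [v]. *)
Definition glue0 (v : nat) (u t : seq nat) : seq nat :=
  map (addn v.+2) u ++ v :: map (bump v) t.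

(** The greatest letter [v] of [t] is expanded into the factor formed by [v], the block and
    [v.+1]. *)
Definition glue1 (v : nat) (u t : seq nat) : seq nat :=
  take (index v t) t ++ v :: map (addn v.+2) u ++
    v.+1 :: drop (index v t).+1 t.

Lemma perm_iota_uniq w n : perm_eq w (iota 0 n) -> uniq w.
Proof. by move/perm_uniq->; apply: iota_uniq. Qed.

Lemma perm_iota_mem w n : perm_eq w (iota 0 n) -> w =i gtn n.
Proof. by move=> /perm_mem pw x; rewrite pw mem_iota. Qed.

Lemma perm_iotaP w n : uniq w -> w =i gtn n -> perm_eq w (iota 0 n).
Proof.
move=> Uw mw; apply: uniq_perm => //; first exact: iota_uniq.
by move=> x; rewrite mw mem_iota.
Qed.

Lemma perm_iotaS v a (u : seq nat) : perm_eq u (iota 0 a) ->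
  perm_eq (iota 0 v ++ v :: v.+1 :: map (addn v.+2) u) (iota 0 (v.+2 + a)).
Proof.
move=> pu; rewrite addSnnS addSnnS iotaD /= perm_cat2l !perm_cons.
by rewrite -[v.+2]addn0 iotaDl addn0 perm_map.
Qed.

Lemma glue0_perm v a u t : perm_eq u (iota 0 a) -> perm_eq t (iota 0 v.+1) ->
  perm_eq (glue0 v u t) (iota 0 (v.+2 + a)).
Proof.
move=> pu pt; apply: perm_trans (perm_iotaS v pu).
have {}pt : perm_eq (map (bump v) t) (iota 0 v ++ [:: v.+1]).
  rewrite (perm_trans (perm_map _ pt)) // -{1}addn1 iotaD map_cat /= /bump leqnn.
  by rewrite (eq_in_map _ id _).1 ?map_id ?addn1 // => x; rewrite mem_iota; lia.
apply/seq.permP => P; move/seq.permP/(_ P): pt; rewrite !count_cat /= => ->.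
by rewrite addn0 addnC -!addnA addnCA.
Qed.

Lemma glue1E v u l r : v \notin l ->
  glue1 v u (l ++ v :: r) = l ++ v :: map (addn v.+2) u ++ v.+1 :: r.
Proof.
move=> vl; rewrite /glue1 index_cat (negPf vl) index_head addn0 take_size_cat //.
by rewrite -[in drop _ _]cat_rcons drop_size_cat // size_rcons.
Qed.

Lemma glue1_split v t : perm_eq t (iota 0 v.+1) ->
  exists l r, [/\ t = l ++ v :: r, v \notin l, all (gtn v) l & all (gtn v) r].
Proof.
move=> pt; have Ut := perm_iota_uniq pt; have mt := perm_iota_mem pt.
have: v \in t by rewrite mt inE /=.
move=> vt; case/splitPr: vt pt Ut mt => l r pt Ut mt; exists l, r.
move: Ut; rewrite cat_uniq /= => /and3P[_ /norP[vl _] /andP[vr _]].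
split=> //; apply/allP => y yi /=.
  have: y != v by apply: contraNneq vl => <-.
  by have:= mt y; rewrite mem_cat yi /= inE /=; lia.
have: y != v by apply: contraNneq vr => <-.
by have:= mt y; rewrite mem_cat inE yi !orbT inE /=; lia.
Qed.

Lemma glue1_perm v a u t : perm_eq u (iota 0 a) -> perm_eq t (iota 0 v.+1) ->
  perm_eq (glue1 v u t) (iota 0 (v.+2 + a)).
Proof.
move=> pu pt; apply: perm_trans (perm_iotaS v pu).
have [l [r [Dt vl _ _]]] := glue1_split pt; rewrite Dt in pt *; rewrite glue1E //.
apply/seq.permP => P; move/seq.permP/(_ P): pt.
by rewrite -[in iota 0 v.+1]addn1 iotaD !count_cat /= !count_cat /= add0n; lia.
Qed.

(** Provides the injectivity in [u] of both gluings. *)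
Lemma filter_high v (l : seq nat) u r : all (gtn v.+2) l -> all (gtn v.+2) r ->
  map (subn^~ v.+2) (filter (leq v.+2) (l ++ map (addn v.+2) u ++ r)) = u.
Proof.
move=> hl hr; have no s : all (gtn v.+2) s -> filter (leq v.+2) s = [::].
  move=> /allP hs; apply/eqP; rewrite -(negbK (_ == _)) -has_filter.
  by apply/hasPn => x /hs /=; lia.
rewrite !filter_cat (no l) // (no r) // cats0 /= filter_map -map_comp.
rewrite (eq_filter (a2 := xpredT)) ?filter_predT => [|x]; last exact: leq_addr.
by apply: map_id_in => x _ /=; rewrite addKn.
Qed.

Lemma map_sub_high m v a : uniq m -> m =i [pred x | v <= x < v + a]%N ->
  perm_eq (map (subn^~ v) m) (iota 0 a) /\ map (addn v) (map (subn^~ v) m) = m.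
Proof.
move=> Um mm; split; last first.
  rewrite -map_comp; apply: map_id_in => x; rewrite mm inE /= => /andP[vx _].
  by rewrite subnKC.
have -> : iota 0 a = map (subn^~ v) (iota v a).
  rewrite -{2}[v]addn0 iotaDl -map_comp map_id_in // => x _ /=.
  by rewrite addKn.
by apply/perm_map/uniq_perm=> //; [exact: iota_uniq|move=> x; rewrite mm mem_iota].
Qed.

(* [glue u t] inserts the letters larger than [v.+1], a shifted copy of [u], as
   a single block; [t] carries the remaining ones except [v] or [v.+1]. *)
Definition glue_spec h v (glue : seq nat -> seq nat -> seq nat) :=
  [/\ forall u t, perm_eq t (iota 0 v.+1) -> exists l r,
        [/\ glue u t = l ++ map (addn v.+2) u ++ r, all (gtn v.+2) l,
            all (gtn v.+2) r & h = 0%N -> l = [::]],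
      forall a u t, perm_eq u (iota 0 a) -> perm_eq t (iota 0 v.+1) ->
        perm_eq (glue u t) (iota 0 (v.+2 + a)) /\ occ_at h (glue u t) v,
      forall u t u' t', perm_eq t (iota 0 v.+1) -> perm_eq t' (iota 0 v.+1) ->
        glue u t = glue u' t' -> t = t' &
      forall a w, perm_eq w (iota 0 (v.+2 + a)) -> occ_at h w v ->
        exists u t, [/\ w = glue u t, perm_eq u (iota 0 a) &
                        perm_eq t (iota 0 v.+1)]].

Lemma glue0_spec v : glue_spec 0 v (glue0 v).
Proof.
have bump_lt t : perm_eq t (iota 0 v.+1) -> all (gtn v.+2) (map (bump v) t).
  move=> /perm_iota_mem mt; apply/allP => _ /mapP[x + ->] /=.
  by rewrite mt inE /= /bump; lia.
split.
- move=> u t pt; exists [::], (v :: map (bump v) t); split=> //=.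
  by rewrite bump_lt // andbT; lia.
- move=> a u t pu pt; have pw := glue0_perm pu pt; split=> //.
  apply/(occ_at0P _ (perm_iota_uniq pw)).
  exists (map (addn v.+2) u), (map (bump v) t); split=> //.
  + by apply/allP => _ /mapP[x _ ->] /=; lia.
  + by have := bump_lt t pt; apply: sub_all => x /=.
  apply/mapP; exists v; last by rewrite /bump leqnn.
  by rewrite (perm_iota_mem pt) inE /=.
- move=> u t u' t' pt pt' e.
  (* Erasing the block leaves [v] followed by the bumped copy of [t], and [bump v] is injective. *)
  have K s x : perm_eq s (iota 0 v.+1) ->
      filter (gtn v.+2) (glue0 v x s) = v :: map (bump v) s.
    move=> /bump_lt /all_filterP ps; rewrite /glue0 filter_cat /= ps.
    rewrite filter_map (eq_filter (a2 := pred0)) ?filter_pred0 => [|y] /=.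
      by rewrite ltnW.
    by apply/negbTE; rewrite -leqNgt leq_addr.
  have [] : v :: map (bump v) t = v :: map (bump v) t' by rewrite -(K t u) // e K.
  exact: (inj_map (can_inj (bumpK v))).
- move=> a w pw; have Uw := perm_iota_uniq pw; have mw := perm_iota_mem pw.
  case/(occ_at0P _ Uw) => m [r [Dw /allP hm /allP hr v1r]].
  move: (Uw); rewrite Dw cat_uniq => /and3P[Um _ /andP[vr Ur]].
  have [] := @map_sub_high m v.+2 a Um.
    move=> x; have := mw x; rewrite Dw mem_cat !inE /=.
    have [/hm/=|xm] := boolP (x \in m); first by lia.
    have [->|] /= := eqVneq x v; first by lia.
    by have [/hr/=|] := boolP (x \in r); lia.
  move=> pu Dm; exists (map (subn^~ v.+2) m), (map (unbump v) r).
  rewrite /glue0 Dm -map_comp; split=> //.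
    congr (_ ++ _ :: _); apply/esym/map_id_in => x xr /=.
    by rewrite unbumpK // inE; apply: contraNneq vr => <-.
  (* With both sides written as images under [unbump v], it remains to see that [r] consists of 0,
     ..., v+1 without [v]. *)
  have {1}-> : iota 0 v.+1 = map (unbump v) (map (bump v) (iota 0 v.+1)).
    by rewrite mapK //; apply: bumpK.
  apply/perm_map/uniq_perm=> //.
    by rewrite map_inj_uniq ?iota_uniq //; exact: can_inj (bumpK v).
  move=> x; apply/idP/mapP => [xr|[y]]; last first.
    rewrite mem_iota /= add0n => yv ->.
    have [->|yv'] := eqVneq y v; first by rewrite /bump leqnn.
    have -> : bump v y = y by rewrite /bump; lia.
    have := mw y; rewrite Dw mem_cat !inE (negPf yv') /=.
    by have [/hm/=|] := boolP (y \in m); lia.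
  have xv : x != v by apply: contraNneq vr => <-.
  exists (unbump v x); last by rewrite unbumpK.
  by have := hr x xr; rewrite mem_iota /unbump /=; lia.
Qed.

Lemma glue1_spec v : glue_spec 1 v (glue1 v).
Proof.
have ltW (s : seq nat) k : all (gtn v) s -> all (gtn (k + v)) s.
  by apply: sub_all => x /= xv; apply: ltn_addl.
split.
- move=> u t /glue1_split[l [r [-> vl hl hr]]]; rewrite glue1E //.
  exists (l ++ [:: v]), (v.+1 :: r); rewrite -catA; split=> //.
    by rewrite all_cat (ltW _ 2) //=; lia.
  by rewrite /= (ltW _ 2) // ltnSn.
- move=> a u t pu pt; have pw := glue1_perm pu pt; split=> //.
  apply/(occ_at1P _ (perm_iota_uniq pw)).
  have /glue1_split[l [r [-> vl hl hr]]] := pt; rewrite glue1E //.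
  exists l, (map (addn v.+2) u), r; split=> //.
  by apply/allP => _ /mapP[x _ ->] /=; lia.
- move=> u t u' t' pt pt' e.
  (* Erasing the block together with [v.+1] restores [t]. *)
  have K s x : perm_eq s (iota 0 v.+1) -> filter (gtn v.+1) (glue1 v x s) = s.
    move=> /glue1_split[l [r [-> vl hl hr]]]; rewrite glue1E // filter_cat /=.
    have/all_filterP -> := ltW l 1%N hl; rewrite ltnSn filter_cat /= ltnn.
    have/all_filterP -> := ltW r 1%N hr.
    rewrite filter_map (eq_filter (a2 := pred0)) ?filter_pred0 // => y /=.
    by apply/negbTE; rewrite -leqNgt; lia.
  by rewrite -(K t u) // e K.
- move=> a w pw; have Uw := perm_iota_uniq pw; have mw := perm_iota_mem pw.
  case/(occ_at1P _ Uw) => l [m [r [Dw /allP hl /allP hm /allP hr]]].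
  have vl : v \notin l by apply/negP => /hl /=; rewrite ltnn.
  (* Moving the block to the front makes the uniqueness of the block and of the remainder directly
     available. *)
  have Ucat : uniq (m ++ l ++ v :: v.+1 :: r).
    rewrite -(perm_uniq (_ : perm_eq w _)) // Dw.
    by apply/seq.permP => P; rewrite !(count_cat, count_map) /= !count_cat /=; lia.
  have mcat x : (x \in w) = [|| x \in m, x \in l, x == v, x == v.+1 | x \in r].
    by rewrite Dw !(mem_cat, inE); do !case: (_ \in _); do !case: eqP.
  move: (Ucat); rewrite cat_uniq => /and3P[Um _ Ulr].
  have [] := @map_sub_high m v.+2 a Um.
    move=> x; have := mw x; rewrite mcat !inE /=.
    have [/hm/=|xm] := boolP (x \in m); first by lia.
    have [/hl/=|xl] := boolP (x \in l); first by lia.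
    by have [/hr/=|] := boolP (x \in r); lia.
  move=> pu Dm; exists (map (subn^~ v.+2) m), (l ++ v :: r).
  rewrite glue1E // Dm Dw; split=> //; apply: perm_iotaP.
    apply: subseq_uniq Ulr; apply: cat_subseq => //.
    exact: (cat_subseq (subseq_refl [:: v]) (subseq_cons r v.+1)).
  move=> x; have := mw x; rewrite mcat !(mem_cat, inE) /=.
  have [/hm/=|xm] := boolP (x \in m).
    have [/hl/=|xl] := boolP (x \in l); first by lia.
    by have [/hr/=|] := boolP (x \in r); lia.
  have [/hl/=|xl] := boolP (x \in l); first by lia.
  by have [/hr/=|] := boolP (x \in r); lia.
Qed.

(** * The recurrence for words *)

(** The bottom value [v.+1] is excluded by [occ_atS]; a bottom value [v.+2 + x] lives in the block,
    where it corresponds to [x] in [u]. *)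
Lemma count_occ_glue h v a u t glue : (h <= 1)%N -> glue_spec h v glue ->
  perm_eq u (iota 0 a) -> perm_eq t (iota 0 v.+1) ->
  count (occ_at h (glue u t)) (iota v.+1 a.+1) = occs h u.
Proof.
move=> h1 [shape perm _ _] pu pt; have [_ ow] := perm a u t pu pt.
rewrite /= (occ_atS h1 ow) add0n /occs (perm_size pu) size_iota.
have [l [r [-> hl hr h0]]] := shape u t pt.
rewrite -{2}[v.+2]addn0 iotaDl count_map; apply: eq_count => x /=.
exact: occ_at_shift.
Qed.

(** Gluing is a bijection from pairs [(u, t)], and the weight does not depend on [t], so the choices
    of [t] contribute a factorial. *)
Lemma sum_occ_at (R : comNzRingType) (x : R) h v a glue :
  (h <= 1)%N -> glue_spec h v glue ->
  \sum_(w <- permutations (iota 0 (v.+2 + a)) | occ_at h w v)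
     x ^+ count (occ_at h w) (iota v.+1 a.+1) =
  (v.+1`!)%:R * \sum_(u <- permutations (iota 0 a)) x ^+ occs h u.
Proof.
move=> h1 gl; have [shape perm inj surj] := gl.
pose s := [seq glue u t | u <- permutations (iota 0 a),
                          t <- permutations (iota 0 v.+1)].
rewrite -big_filter (perm_big s); last first.
  apply: uniq_perm; first by rewrite filter_uniq ?permutations_uniq.
    apply: allpairs_uniq; rewrite ?permutations_uniq //.
    move=> _ _ /allpairsP[[u t] /= [_ + ->]] /allpairsP[[u' t'] /= [_ + ->]] /=.
    rewrite !mem_permutations => pt pt' e; congr (_, _); last exact: inj e.
    have [l [r [D hl hr _]]] := shape u t pt.
    have [l' [r' [D' hl' hr' _]]] := shape u' t' pt'.
    by rewrite -(filter_high u hl hr) -D e D' filter_high.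
  move=> w; rewrite mem_filter mem_permutations.
  apply/andP/allpairsP => [[ow pw]|[[u t] /=]].
    have [u [t [-> pu pt]]] := surj a w pw ow.
    by exists (u, t); rewrite !mem_permutations.
  rewrite !mem_permutations => -[pu pt ->].
  by have [] := perm a u t pu pt.
rewrite big_allpairs_dep mulr_sumr; apply: eq_big_seq => u.
rewrite mem_permutations => pu.
rewrite (eq_big_seq (fun=> x ^+ occs h u)) => [|t].
  rewrite big_const_seq count_predT size_permutations ?iota_uniq // size_iota.
  by rewrite iter_addr_0 mulr_natl.
by rewrite mem_permutations => pt; rewrite (count_occ_glue h1 gl pu pt).
Qed.

(** After the geometric expansion the two sums are exchanged, which fixes the marked bottom value
    [v]; the part sizes are then b = v + 1 and a = n - 2 - v. *)
Lemma word_recurrence (R : comNzRingType) (x : R) h n : (h <= 1)%N ->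
  let D k := \sum_(w <- permutations (iota 0 k)) x ^+ occs h w in
  D n = (n`!)%:R + (x - 1) * \sum_(v < n.-1) (v.+1`!)%:R * D (n.-2 - v)%N.
Proof.
move=> h1 D; rewrite {1}/D.
rewrite (eq_big_seq (fun w => 1 + (x - 1) * \sum_(v <- iota 0 n | occ_at h w v)
    x ^+ count (occ_at h w) (iota v.+1 (n - v.+1)))); last first.
  move=> w; rewrite mem_permutations => pw.
  by rewrite /occs (perm_size pw) size_iota expX_count_sub1 add0n.
rewrite big_split /= big_const_seq count_predT size_permutations ?iota_uniq //.
rewrite size_iota iter_addr_0 -mulr_sumr; congr (_ + _ * _).
rewrite (exchange_big_dep xpredT) //=.
case: n => [|n]; first by rewrite big_nil big_ord0.
set p := permutations _.
(* The greatest letter [n] cannot be a bottom value, which removes the last index. *)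
have nil (G : seq nat -> R) : \sum_(w <- p | occ_at h w n) G w = 0.
  rewrite big_seq_cond big_pred0 // => w; apply/andP => -[].
  rewrite mem_permutations => pw /occ_at_mem/andP[_].
  by rewrite (perm_iota_mem pw) inE /= ltnn.
rewrite -{1}[n.+1]subn0 -/(index_iota 0 n.+1) big_mkord big_ord_recr /= nil addr0.
rewrite {nil}/p {p}; apply: eq_bigr => v _; have ltvn := ltn_ord v.
rewrite (_ : iota 0 n.+1 = iota 0 (v.+2 + (n.-1 - v))); last by congr iota; lia.
rewrite (_ : (n.+1 - v.+1 = (n.-1 - v).+1)%N); last by lia.
case: h h1 @D => [|[|//]] h1 D.
  exact: sum_occ_at (glue0_spec v).
exact: sum_occ_at (glue1_spec v).
Qed.

(** * From permutations and shaded boxes to words *)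

Definition word n (s : 'S_n) : seq nat := [seq val (s i) | i <- enum 'I_n].

Lemma word_iota n (s : 'S_n) : perm_eq (word s) (iota 0 n).
Proof.
rewrite /word -val_enum_ord map_comp; apply/perm_map/uniq_perm.
- by rewrite map_inj_uniq ?enum_uniq //; apply: perm_inj.
- exact: enum_uniq.
by move=> i; rewrite mem_enum -{1}[i](permKV s) map_f // mem_enum.
Qed.

Lemma word_inj n : injective (@word n).
Proof.
move=> s t /eq_in_map e; apply/permP => i.
by apply/val_inj/e; rewrite mem_enum.
Qed.

Lemma index_word n (s : 'S_n) (i : 'I_n) : index (val (s i)) (word s) = i.
Proof.
rewrite /word (index_map (f := fun i => val (s i))) ?index_enum_ord //.
exact: inj_comp val_inj perm_inj.
Qed.

Lemma words_permutations n :
  perm_eq (map (@word n) (enum 'S_n)) (permutations (iota 0 n)).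
Proof.
have U : uniq (map (@word n) (enum 'S_n)).
  by rewrite map_inj_uniq ?enum_uniq //; apply: word_inj.
apply: uniq_perm; rewrite ?permutations_uniq //.
apply: (uniq_min_size U _ _).2 => [_ /mapP[s _ ->]|].
  by rewrite mem_permutations word_iota.
by rewrite size_permutations ?iota_uniq // size_iota size_map -cardE card_Sn.
Qed.

(** The column (or row) of the mesh containing [k], for [i < j] and [k] distinct from both. *)
Definition strip (i j k : nat) : 'I_3 := inord ((i < k) + (j < k)).

Lemma val_strip i j k : strip i j k = ((i < k) + (j < k))%N :> nat.
Proof. by rewrite inordK //; case: (i < k)%N; case: (j < k)%N. Qed.

Lemma cut_strip n u v k (a : 'I_3) : (u < v < n)%N -> (k < n)%N ->
  (cut n u v a < k.+1 < cut n u v a.+1)%N = [&& k != u, k != v & a == strip u v k].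
Proof.
rewrite -val_eqE /= val_strip /cut.
by case: a => -[|[|[|//]]] lta; rewrite /= => /andP[uv vn] kn; lia.
Qed.

(** Every other letter lies in exactly one box, so the quantifier over shaded boxes can be traded
    for one over letters. *)
Lemma is_occurrenceE n (p : mesh12) (s : 'S_n) (i j : 'I_n) :
  is_occurrence p s i j = [&& (i < j)%N, (s i < s j)%N &
    [forall k : 'I_n, [|| k == i, k == j |
       (strip i j k, strip (s i) (s j) (s k)) \notin p]]].
Proof.
rewrite /is_occurrence; case: ltnP => //= ij; case: ltnP => //= sij.
have box (k : 'I_n) (c : 'I_3 * 'I_3) :
    (cut n i j c.1 < k.+1 < cut n i j c.1.+1)%N &&
    (cut n (s i) (s j) c.2 < (s k).+1 < cut n (s i) (s j) c.2.+1)%N =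
    [&& k != i, k != j & c == (strip i j k, strip (s i) (s j) (s k))].
  rewrite !cut_strip ?ij ?sij ?ltn_ord // !val_eqE !(inj_eq perm_inj).
  case: c => a b; rewrite xpair_eqE /=.
  by case: (k == i); case: (k == j); rewrite ?andbF.
apply/forall_inP/forallP => [H k|H c cp].
  case: eqVneq => //= ki; case: eqVneq => //= kj; apply/negP => kp.
  by case/existsP: (H _ kp); exists k; rewrite box ki kj /=.
apply/existsP => -[k]; rewrite box => /and3P[ki kj /eqP Dc].
by have := H k; rewrite (negPf ki) (negPf kj) -Dc cp.
Qed.

(** * Symmetries: inverse and reverse-complement *)

Definition mesh_inv (p : mesh12) : mesh12 := [set c | (c.2, c.1) \in p].

Definition mesh_rc (p : mesh12) : mesh12 :=
  [set c | (rev_ord c.1, rev_ord c.2) \in p].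

Definition rc_perm n (s : 'S_n) : 'S_n :=
  perm (inj_comp (@rev_ord_inj n) (inj_comp (@perm_inj _ s) (@rev_ord_inj n))).

Lemma rc_permE n (s : 'S_n) i : rc_perm s i = rev_ord (s (rev_ord i)).
Proof. by rewrite permE. Qed.

Lemma rc_permK n : involutive (@rc_perm n).
Proof. by move=> s; apply/permP => i; rewrite !rc_permE !rev_ordK. Qed.

Lemma is_occurrence_inv n (p : mesh12) (s : 'S_n) (i j : 'I_n) :
  is_occurrence (mesh_inv p) s^-1%g (s i) (s j) = is_occurrence p s i j.
Proof.
rewrite !is_occurrenceE !permK andbCA; congr [&& _, _ & _].
apply/forallP/forallP => H k.
  by have := H (s k); rewrite !permK !(inj_eq perm_inj) inE.
by have := H (s^-1%g k); rewrite !permKV inE -!(can2_eq (permKV s) (permK s)).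
Qed.

(** Off the two cut lines, reversal exchanges lying before and lying after a line; on a line both
    strict comparisons would fail. *)
Lemma strip_rev n (i j k : 'I_n) : (i < j)%N -> k != i -> k != j ->
  strip (rev_ord j) (rev_ord i) (rev_ord k) = rev_ord (strip i j k).
Proof.
move=> ij; rewrite -!val_eqE /= => ki kj; apply/val_inj.
have := ltn_ord i; have := ltn_ord j; have := ltn_ord k.
by rewrite /= !val_strip /=; lia.
Qed.

(** The half-turn of the diagram exchanges the two points of the occurrence, hence the order
    [rev_ord j], [rev_ord i]. *)
Lemma is_occurrence_rc n (p : mesh12) (s : 'S_n) (i j : 'I_n) :
  is_occurrence (mesh_rc p) (rc_perm s) (rev_ord j) (rev_ord i) =
  is_occurrence p s i j.
Proof.
have rev_lt (a b : 'I_n) : (rev_ord b < rev_ord a)%N = (a < b)%N.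
  by have := ltn_ord a; have := ltn_ord b; rewrite /=; lia.
rewrite !is_occurrenceE !rc_permE !rev_ordK !rev_lt.
case: ltnP => //= ij; case: ltnP => //= sij.
have E k : [|| rev_ord k == rev_ord j, rev_ord k == rev_ord i
   | (strip (rev_ord j) (rev_ord i) (rev_ord k),
      strip (rev_ord (s j)) (rev_ord (s i)) (rc_perm s (rev_ord k)))
       \notin mesh_rc p] =
   [|| k == i, k == j | (strip i j k, strip (s i) (s j) (s k)) \notin p].
  rewrite !(inj_eq rev_ord_inj) orbCA; case: eqVneq => //= ki.
  case: eqVneq => //= kj.
  by rewrite rc_permE rev_ordK !strip_rev ?(inj_eq perm_inj) // inE /= !rev_ordK.
apply/forallP/forallP => H k; first by rewrite -E.
by rewrite -[k]rev_ordK E.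
Qed.

Lemma occurrences_inv n (p : mesh12) (s : 'S_n) :
  occurrences (mesh_inv p) s^-1%g = occurrences p s.
Proof.
pose f (ij : 'I_n * 'I_n) := (s ij.1, s ij.2).
pose g (ij : 'I_n * 'I_n) := (s^-1%g ij.1, s^-1%g ij.2).
have bf : bijective f.
  by exists g => -[i j]; rewrite /f /g /= ?permK ?permKV.
rewrite /occurrences -(on_card_preimset (onW_bij _ bf)); apply: eq_card => -[i j].
by rewrite !inE is_occurrence_inv.
Qed.

Lemma occurrences_rc n (p : mesh12) (s : 'S_n) :
  occurrences (mesh_rc p) (rc_perm s) = occurrences p s.
Proof.
pose f (ij : 'I_n * 'I_n) := (rev_ord ij.2, rev_ord ij.1).
have bf : bijective f by exists f => -[i j]; rewrite /f /= !rev_ordK.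
rewrite /occurrences -(on_card_preimset (onW_bij _ bf)); apply: eq_card => -[i j].
by rewrite !inE is_occurrence_rc.
Qed.

Lemma distribution_inv p :
  distribution_series (mesh_inv p) =1 distribution_series p.
Proof.
move=> n; rewrite /distribution_series (reindex_inj invg_inj) /=.
by apply: eq_bigr => s _; rewrite occurrences_inv.
Qed.

Lemma distribution_rc p :
  distribution_series (mesh_rc p) =1 distribution_series p.
Proof.
move=> n; rewrite /distribution_series (reindex_inj (inv_inj (@rc_permK n))) /=.
by apply: eq_bigr => s _; rewrite occurrences_rc.
Qed.

(** * The two representative patterns *)

(** The boxes left unshaded are the top one in column [h] and the bottom ones in the other columns:
    [h = 0] is the first pattern, [h = 1] the fifth. *)
Definition block_mesh (h : nat) : mesh12 :=
  [set c : 'I_3 * 'I_3 | ~~ ((c.2 != 1%N :> nat) &&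
     ((c.2 == 2%N :> nat) == (c.1 == h :> nat)))].

Lemma is_occurrence_block n h (s : 'S_n) (i j : 'I_n) :
  is_occurrence (block_mesh h) s i j =
  (s j == (s i).+1 :> nat) && occ_at h (word s) (s i).
Proof.
have sE (k l : 'I_n) : (k == l) = (s k == s l :> nat).
  by rewrite (inj_eq val_inj) (inj_eq perm_inj).
have mw k : val (s k) \in word s by apply/map_f; rewrite mem_enum.
rewrite is_occurrenceE; apply/and3P/andP => [[ij sij /forallP H]|[/eqP Dsj]].
  have Dsj : s j = (s i).+1 :> nat.
    (* Otherwise the letter of value [(s i).+1] would lie in the middle row, which is entirely
       shaded. *)
    apply/eqP; rewrite eqn_leq sij andbT leqNgt; apply/negP => lt_s.
    have ltn1 := ltn_trans lt_s (ltn_ord (s j)).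
    have Dk : s (s^-1%g (Ordinal ltn1)) = (s i).+1 :> nat by rewrite permKV.
    have := H (s^-1%g (Ordinal ltn1)).
    rewrite !sE Dk inE !val_strip /=.
    by lia.
  split; first by rewrite Dsj.
  rewrite /occ_at -Dsj mw !index_word ij; apply/allP => _ /mapP[k _ ->].
  have := H k; rewrite !sE inE !val_strip /=.
  by rewrite index_word; lia.
case/and3P; rewrite -Dsj !index_word => _ ij /allP H; split=> //.
apply/forallP => k; have := H _ (mw k); rewrite index_word.
rewrite !sE inE !val_strip /=.
by lia.
Qed.

(** An occurrence is determined by its bottom value, the top value being the next integer. *)
Lemma occurrences_block n h (s : 'S_n) :
  occurrences (block_mesh h) s = occs h (word s).
Proof.
rewrite /occurrences; set A := [set _ | _].
have injA : {in A &, injective (fun ij => s ij.1)}.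
  move=> [i j] [i' j']; rewrite !inE /= !is_occurrence_block.
  move=> /andP[/eqP Dj _] /andP[/eqP Dj' _] /perm_inj Di; rewrite Di in Dj *.
  by congr (_, _); apply/(@perm_inj _ s)/val_inj; rewrite /= Dj Dj'.
rewrite -(card_in_imset injA) /occs size_map size_enum_ord -val_enum_ord count_map.
rewrite -size_filter cardE {1}/enum_mem enumT; congr size; apply: eq_filter.
move=> v; apply/imsetP/idP => [[[i j] + ->]|ov].
  by rewrite inE /= is_occurrence_block => /andP[].
have /andP[_ /mapP[j _ Dj]] := occ_at_mem ov.
exists (s^-1%g v, j); last by rewrite /= permKV.
by rewrite inE /= is_occurrence_block permKV -Dj eqxx.
Qed.

(** The functional equation of F(x,q), read at x^n; for n <= 1 the sum is empty, so the truncated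
    [n.-2] does no harm. *)
Definition fact_recurrence (p : mesh12) : Prop :=
  let D := distribution_series p in forall n, D n = (n`!)%:R +
    ('X - 1) * \sum_(v < n.-1) (v.+1`!)%:R * D (n.-2 - v)%N.

Lemma block_recurrence h : (h <= 1)%N -> fact_recurrence (block_mesh h).
Proof.
move=> h1 D n.
have DE k : D k = \sum_(w <- permutations (iota 0 k)) 'X^(occs h w).
  rewrite -(perm_big _ (words_permutations k)) big_map /= big_enum.
  by apply: eq_bigr => s _; rewrite occurrences_block.
rewrite DE (word_recurrence _ _ h1); congr (_ + _ * _).
by apply: eq_bigr => v _; rewrite DE.
Qed.

Lemma eq_fact_recurrence p p' : distribution_series p =1 distribution_series p' ->
  fact_recurrence p' -> fact_recurrence p.
Proof.
move=> e H D n; rewrite /D e H; congr (_ + _ * _).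
by apply: eq_bigr => v _; rewrite e.
Qed.

(** * The eight patterns and their generating functions *)

(** Two orbits of four patterns under the symmetries; each equality is checked on the nine boxes. *)
Lemma eight_patternsE : eight_patterns =
  [:: block_mesh 0; mesh_rc (mesh_inv (block_mesh 0)); mesh_inv (block_mesh 0);
      mesh_rc (block_mesh 0); block_mesh 1; mesh_rc (mesh_inv (block_mesh 1));
      mesh_rc (block_mesh 1); mesh_inv (block_mesh 1)].
Proof.
rewrite /eight_patterns /=; congr [:: _; _; _; _; _; _; _; _]; apply/setP;
by move=> [[[|[|[|//]]] ?] [[|[|[|//]]] ?]]; rewrite !inE.
Qed.

Lemma eight_patterns_recurrence p : p \in eight_patterns -> fact_recurrence p.
Proof.
have rec_inv q : fact_recurrence q -> fact_recurrence (mesh_inv q).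
  exact/eq_fact_recurrence/distribution_inv.
have rec_rc q : fact_recurrence q -> fact_recurrence (mesh_rc q).
  exact/eq_fact_recurrence/distribution_rc.
have rec0 := @block_recurrence 0 isT; have rec1 := @block_recurrence 1 isT.
rewrite eight_patternsE !inE.
by do 7?[case/predU1P => [->|]; first by auto] => /eqP->; auto.
Qed.

Lemma coef_distribution p n k :
  (distribution_series p n)`_k = (s_count p n k)%:R.
Proof.
rewrite /distribution_series coef_sum /s_count -sum1dep_card natr_sum.
rewrite [RHS]big_mkcond /=; apply: eq_bigr => s _.
by rewrite coefXn eq_sym; case: eqP.
Qed.

(** Evaluation at q = 0 is a ring morphism and keeps only the constant coefficient, which counts the
    avoiders. *)
Lemma avoidance_recurrence p : fact_recurrence p ->
  let A := avoidance_series p in forall n, A n = (n`!)%:R +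
    (0 - 1) * \sum_(v < n.-1) (v.+1`!)%:R * A (n.-2 - v)%N.
Proof.
move=> H A n.
have AE k : A k = horner_eval 0 (distribution_series p k).
  by rewrite /horner_eval horner_coef0 coef_distribution.
rewrite AE H rmorphD rmorphM rmorphB rmorph1 rmorph_nat rmorph_sum.
rewrite [X in X - 1](hornerX 0); congr (_ + _ * _).
by apply: eq_bigr => v _; rewrite rmorphM rmorph_nat AE.
Qed.

Theorem theorem4p1 :
  (forall p1 p2 : mesh12,
     p1 \in eight_patterns -> p2 \in eight_patterns -> equidistributed p1 p2) /\
  (forall p : mesh12, p \in eight_patterns ->
     avoidance_series p =1
       (fact_series int / (1 + 'x * (fact_series int - 1)))%S /\
     distribution_series p =1
       (fact_series {poly int} /
          (1 + (1 - 'X%R)%R%:S * 'x * (fact_series {poly int} - 1)))%S).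
Proof.
have distr p : p \in eight_patterns -> distribution_series p =1
    (fact_series {poly int} /
       (1 + (1 - 'X%R)%R%:S * 'x * (fact_series {poly int} - 1)))%S.
  (* The goals left are the coefficients of the denominator in degrees 0, 1 and m + 2. *)
  move=> /eight_patterns_recurrence H; apply: fps_div_fact H _ _ _ => [||m];
    rewrite /fps_add -fps_mulA fps_mulCl.
  - by rewrite /fps_mul big_ord1 mul0r mulr0 addr0.
  - by rewrite fps_mulXl /fps_opp /fact_series /= subrr mulr0 addr0.
  - by rewrite fps_mulXl /fps_opp /fact_series /= subr0 add0r.
split=> [p1 p2 H1 H2 n k|p Hp].
  (* Both counts are the coefficient of q^k in the same polynomial, since the closed form does not
     depend on the pattern. *)
  have: (s_count p1 n k)%:R = (s_count p2 n k)%:R :> int.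
    by rewrite -!coef_distribution (distr p1) // -(distr p2).
  by rewrite !natz => -[].
split; last exact: distr.
have H := avoidance_recurrence (eight_patterns_recurrence Hp).
apply: fps_div_fact H _ _ _ => [||m]; rewrite /fps_add.
- by rewrite /fps_mul big_ord1 mul0r addr0.
- by rewrite fps_mulXl /fps_opp /fact_series subrr.
- by rewrite fps_mulXl /fps_opp /fact_series /= !subr0 add0r mul1r.
Qed.
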